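(* Let $\mathbb{X}$ be a complex Banach space and let $T \in \mathbb{L}(\mathbb{X}, \mathbb{X}^* )$ be bijective. Then $\mathbb{X}$ is reflexive if and only if for any nonzero $x \in \mathbb{X}$ there exists $z \in \mathbb{X}$ such that $z \perp_B x^{\perp_T}$.
   Context: $\mathbb{X}^*$ is the dual space of $\mathbb{X}$ and $\mathbb{L}(\mathbb{X},\mathbb{X}^* )$ is the set of all bounded linear operators from $\mathbb{X}$ to $\mathbb{X}^*$. For $x,y\in\mathbb{X}$, $x \perp_T y$ means $Tx(y)=0$, and $x^{\perp_T}=\{y\in\mathbb{X}: x\perp_T y\}$. Birkhoff-James orthogonality: $x\perp_B y$ means $\|x+\lambda y\|\ge\|x\|$ for all $\lambda\in\mathbb{C}$. For a set $S\subset\mathbb{X}$, $z\perp_B S$ means $z\perp_B y$ for all $y\in S$.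
   Formalization: The element z is required to be nonzero; with z = 0 allowed the condition always holds, and the claim fails for the nonreflexive space J ⊕ J* (J the James space), which is isomorphic to its dual. *)

(* Defs.v *)
From HB Require Import structures.
From mathcomp Require Import all_boot all_order all_algebra.
From mathcomp Require Import all_classical all_reals all_analysis.
From mathcomp Require Import complex.
Set Implicit Arguments.
Unset Strict Implicit.
Unset Printing Implicit Defensive.
Import Order.TTheory GRing.Theory Num.Theory.
Import numFieldNormedType.Exports.
Local Open Scope classical_set_scope.
Local Open Scope ring_scope.
Local Open Scope complex_scope.

(* A complex normed space is a normed module over R[i]; its norm takes values
   in R[i], all of them nonnegative reals (the order of R[i] is the partial
   order in which z <= w means that w - z is a nonnegative real). *)

Definition bounded_op (R : realType) (X Y : normedModType R[i]) (f : X -> Y) :=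
  exists M : R, forall x, `|f x| <= M%:C * `|x|.

Definition bounded_linear (R : realType) (X Y : normedModType R[i]) :
    {pred X -> Y} :=
  fun f => `[< linear f /\ bounded_op f >].

Record blinop (R : realType) (X Y : normedModType R[i]) := BLinOp {
  blinop_fun :> X -> Y;
  blinopP : blinop_fun \in @bounded_linear R X Y }.

Section BoundedLinear.
Variables (R : realType) (X Y : normedModType R[i]).

Lemma bounded_linear_submod : submod_closed (@bounded_linear R X Y).
Proof.
split=> [|a f g].
  apply/asboolP; split; first by move=> a x y; rewrite scaler0 addr0.
  by exists 0 => x; rewrite normr0 mul0r.
move=> /asboolP[lf [Mf fM]] /asboolP[lg [Mg gM]]; apply/asboolP; split.
  move=> b x y; rewrite !fctE lf lg !scalerDr !scalerA mulrC -!addrA.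
  by congr (_ + _); rewrite addrCA.
exists (complex.Re `|a| * Mf + Mg) => x; rewrite !fctE.
have aE : (complex.Re `|a|)%:C = `|a| by rewrite RRe_real// normr_real.
rewrite rmorphD rmorphM/= aE mulrDl.
apply: (le_trans (ler_normD _ _)); apply: lerD; last exact: gM.
by rewrite normrZ -mulrA ler_wpM2l.
Qed.

HB.instance Definition _ :=
  GRing.isSubmodClosed.Build R[i] (X -> Y) (@bounded_linear R X Y)
    bounded_linear_submod.

HB.instance Definition _ := [isSub for @blinop_fun R X Y].
HB.instance Definition _ := [Choice of blinop X Y by <:].
HB.instance Definition _ := [SubChoice_isSubLmodule of blinop X Y by <:].

Lemma blinop_linear (f : blinop X Y) : linear f.
Proof. by have /asboolP[] := blinopP f. Qed.

Lemma blinop_bounded (f : blinop X Y) : bounded_op f.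
Proof. by have /asboolP[] := blinopP f. Qed.

HB.instance Definition _ (f : blinop X Y) :=
  GRing.isLinear.Build R[i] X Y _ (blinop_fun f) (blinop_linear f).

Definition opnorm (f : blinop X Y) : R :=
  sup [set complex.Re `|f x| | x in [set x | `|x| <= 1]].

Lemma Re_norm (V : normedModType R[i]) (v : V) : (complex.Re `|v|)%:C = `|v|.
Proof. by rewrite RRe_real// normr_real. Qed.

Lemma opnorm_has_sup (f : blinop X Y) :
  has_sup [set complex.Re `|f x| | x in [set x | `|x| <= 1]].
Proof.
split; first by exists (complex.Re `|f 0|); exists 0; rewrite /= ?normr0.
have [M fM] := blinop_bounded f; exists `|M| => _ [x /= x1 <-].
rewrite -lecR Re_norm; apply: (le_trans (fM x)).
apply: (@le_trans _ _ (`|M|%:C * `|x|)).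
  by rewrite ler_wpM2r// lecR ler_norm.
by rewrite ler_piMr// ler0c.
Qed.

Lemma opnorm_ge0 (f : blinop X Y) : 0 <= opnorm f.
Proof.
apply: (sup_upper_bound (opnorm_has_sup f)).
by exists 0; rewrite /= ?normr0// linear0 normr0.
Qed.

Lemma ler_opnorm (f : blinop X Y) x : `|f x| <= (opnorm f)%:C * `|x|.
Proof.
have [->|x0] := eqVneq x 0; first by rewrite linear0 !normr0 mulr0.
have nx : 0 < `|x| by rewrite normr_gt0.
rewrite -ler_pdivrMr// mulrC.
have -> : `|x|^-1 * `|f x| = `|f (`|x|^-1 *: x)|.
  by rewrite linearZ/= normrZ ger0_norm// invr_ge0 ltW.
rewrite -Re_norm lecR; apply: (sup_upper_bound (opnorm_has_sup f)).
exists (`|x|^-1 *: x) => //=.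
by rewrite normrZ normfV normr_id mulVf ?gt_eqF.
Qed.

Lemma opnorm_le (f : blinop X Y) (M : R) : 0 <= M ->
  (forall x, `|f x| <= M%:C * `|x|) -> opnorm f <= M.
Proof.
move=> M0 fM; apply: ge_sup; first by case: (opnorm_has_sup f).
move=> _ [x /= x1 <-]; rewrite -lecR Re_norm (le_trans (fM x))//.
by rewrite ler_piMr// ler0c.
Qed.

Lemma blinopDE (f g : blinop X Y) x : (f + g) x = f x + g x.
Proof. by rewrite -[blinop_fun (f + g)]/(val (f + g)) raddfD. Qed.

Lemma blinopZE (a : R[i]) (f : blinop X Y) x : (a *: f) x = a *: f x.
Proof. by []. Qed.

Lemma opnormD (f g : blinop X Y) :
  (opnorm (f + g))%:C <= (opnorm f)%:C + (opnorm g)%:C.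
Proof.
rewrite -rmorphD lecR opnorm_le ?addr_ge0 ?opnorm_ge0// => x.
rewrite blinopDE (le_trans (ler_normD _ _))// rmorphD mulrDl.
by rewrite lerD// ler_opnorm.
Qed.

Lemma opnormZ (a : R[i]) (f : blinop X Y) :
  (opnorm (a *: f))%:C = `|a| * (opnorm f)%:C.
Proof.
have le b (h : blinop X Y) : (opnorm (b *: h))%:C <= `|b| * (opnorm h)%:C.
  have bE : (complex.Re `|b|)%:C = `|b| by rewrite RRe_real// normr_real.
  rewrite -bE -rmorphM lecR opnorm_le//.
    by rewrite mulr_ge0 ?opnorm_ge0// -ler0c bE.
  move=> x; rewrite blinopZE normrZ rmorphM/= bE -mulrA.
  by rewrite ler_wpM2l// ler_opnorm.
apply/le_anti; rewrite le/=.
have [->|a0] := eqVneq a 0; first by rewrite normr0 mul0r ler0c opnorm_ge0.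
rewrite -ler_pdivlMl ?normr_gt0// -normfV.
by rewrite -{1}(scalerK a0 f) le.
Qed.

Lemma opnorm0_eq0 (f : blinop X Y) : (opnorm f)%:C = 0 -> f = 0.
Proof.
move=> f0; apply/val_inj/funext => x; apply/eqP.
rewrite raddf0 -normr_le0.
by rewrite (le_trans (ler_opnorm f x))// f0 mul0r.
Qed.

HB.instance Definition _ := Lmodule_isNormed.Build R[i] (blinop X Y)
  opnormD opnormZ opnorm0_eq0.

End BoundedLinear.

Section Dual.
Variables (R : realType) (X : normedModType R[i]).

Definition topdual := blinop X R[i]^o.

HB.instance Definition _ := NormedModule.on topdual.

End Dual.

Section Reflexive.
Variables (R : realType) (X : normedModType R[i]).

Definition evaluation (x : X) (f : topdual X) : R[i]^o := f x.

Lemma evaluationP (x : X) : evaluation x \in @bounded_linear R (topdual X) R[i]^o.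
Proof.
apply/asboolP; split; first by [].
exists (complex.Re `|x|) => f.
rewrite Re_norm mulrC; exact: ler_opnorm.
Qed.

Definition canonical_embedding (x : X) : topdual (topdual X) :=
  BLinOp (evaluationP x).

Definition reflexive_space := set_surj setT setT canonical_embedding.

End Reflexive.

Definition BJ_orthogonal (R : realType) (X : normedModType R[i]) (x y : X) :=
  forall l : R[i], `|x| <= `|x + l *: y|.

Definition BJ_orthogonal_set (R : realType) (X : normedModType R[i])
    (z : X) (S : set X) :=
  forall y, S y -> BJ_orthogonal z y.

Definition T_orthogonal (R : realType) (X : normedModType R[i])
    (T : blinop X (topdual X)) (x y : X) :=
  T x y = 0.

Definition T_orthocomplement (R : realType) (X : normedModType R[i])
    (T : blinop X (topdual X)) (x : X) : set X :=
  [set y | T_orthogonal T x y].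

(* Main.v *)
Require Import Defs.
From mathcomp Require Import all_boot all_order all_algebra.
From mathcomp Require Import all_classical all_reals all_analysis.
From mathcomp Require Import complex ring lra.
Set Implicit Arguments.
Unset Strict Implicit.
Import Order.TTheory GRing.Theory Num.Theory numFieldNormedType.Exports.
Local Open Scope classical_set_scope.
Local Open Scope ring_scope.
Local Open Scope complex_scope.

(** If [X] is reflexive, Hahn-Banach in [X*] gives a point of the unit ball where
    [T x] attains its norm, and such a point is orthogonal to the kernel of
    [T x]. Conversely, since [T] is onto, the orthogonality condition says that
    every functional attains its norm, so the content is James' theorem: a
    non-reflexive Banach space carries a functional that does not attain its
    norm. Take [Phi] in [X**] at positive distance from [X]. Applying Helly's
    theorem alternately on [X*] and on [X] produces functionals [f_n] and points
    [x_n] of the unit balls with [Re f_n(x_k)] large for [n <= k] and small for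
    [k < n]. Choose convex combinations [g_n] of tails of [(f_n)] greedily, each
    nearly minimizing over all further choices the worst distance from
    [sum_(j < n) (1 - r) r^j g_j + r^n g_n] to the cluster points [w] still
    allowed, and then restricting these [w] by one inequality at a point which
    forces that distance to be nearly reached. If [w] is a cluster point of
    [(g_n)] and [h = sum_j (1 - r) r^j g_j], then [h - w] does not attain its
    norm: at a maximum point every [g_n] would exceed [w] by a fixed amount. *)

(* [l] lies between [liminf u] and [limsup u]. *)
Definition between (R : realType) (u : nat -> R) (l : R) :=
  forall c J, ((forall j, (J <= j)%N -> c <= u j) -> c <= l) /\
              ((forall j, (J <= j)%N -> u j <= c) -> l <= c).

Lemma convex_ge (R : realType) (c u v t : R) : c <= u -> c <= v ->
  0 <= t <= 1 -> c <= t * u + (1 - t) * v.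
Proof.
move=> cu cv /andP[t0 t1]; rewrite -subr_ge0.
have -> : t * u + (1 - t) * v - c = t * (u - c) + (1 - t) * (v - c) by ring.
by rewrite addr_ge0// mulr_ge0// subr_ge0.
Qed.

(** * The non-attainment construction *)

Section Core.
Variables (R : realType) (E : Type) (B : set E) (G : nat -> set (E -> R)).

Definition convex_fun_set (C : set (E -> R)) := forall f g t, C f -> C g ->
  0 <= t <= 1 -> C (fun x => t * f x + (1 - t) * g x).

(* [G N] stands for the convex hull of the tail [f_N, f_(N+1), ...]; a set is
   large when it has cluster points along these tails. *)
Definition large (C : set (E -> R)) := forall N, exists f, C f /\ G N f.

(* Up to an arbitrarily small increase of [a], this is the inequality
   [h - w <= a] on [B] for all cluster points [w] of [C] along [G]. *)
Definition eventual_ub (C : set (E -> R)) (h : E -> R) (a : R) :=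
  forall x, B x -> exists N, forall f, C f -> G N f -> h x - f x <= a.

Definition level_set (C : set (E -> R)) (p : E -> R) (t : R) : set R :=
  [set a | exists g D, [/\ C g, D `<=` C, convex_fun_set D, large D &
                         eventual_ub D (fun x => p x + t * g x) a]].

Definition level C p t := inf (level_set C p t).

Hypothesis Gdecr : forall m n, (m <= n)%N -> G n `<=` G m.
Hypothesis Gconvex : forall n, convex_fun_set (G n).
Hypothesis Gnonempty : forall n, exists f, G n f.
Hypothesis Gbounded : forall f x, G 0 f -> B x -> `|f x| <= 1.
Variable th : R.
Hypothesis Ggap : forall g, G 0 g -> exists x N, B x /\
  forall f, G N f -> th <= g x - f x.

Variable r : R.
Hypothesis r01 : 0 < r < 1.

Let r01W : 0 <= r <= 1. Proof. by case/andP: r01 => /ltW-> /ltW->. Qed.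

(* A state [s = (C, p)] at stage [i]: [C] is the set of functions still allowed
   and [p = \sum_(j < i) (1 - r) r^j g_j] is the sum of the choices made so far. *)
Definition admissible i (s : set (E -> R) * (E -> R)) :=
  [/\ convex_fun_set s.1, large s.1, s.1 `<=` G i &
      forall g, s.1 g -> G 0 (fun x => s.2 x + r ^+ i * g x)].

(** Admissibility puts [p + r^i g] in [G 0], so [Ggap] gives a point where it exceeds all late
    functions by at least [th]; a large [D] contains one to which the eventual bound applies. *)
Lemma level_set_ge i s : admissible i s ->
  lbound (level_set s.1 s.2 (r ^+ i)) th.
Proof.
move=> [_ _ _ sG] a [g [D [sg Ds _ lD ub]]].
have [x [N [Bx gap]]] := Ggap (sG _ sg).
have [N' ubx] := ub x Bx.
have [f [Df Gf]] := lD (maxn N N').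
apply: le_trans (ubx f Df _); last by apply: Gdecr Gf; rewrite leq_maxr.
by apply: gap; apply: Gdecr Gf; rewrite leq_maxl.
Qed.

Lemma level_set_nonempty i s : admissible i s ->
  level_set s.1 s.2 (r ^+ i) 2.
Proof.
move=> [cs ls _ sG]; have [g [sg _]] := ls 0%N.
exists g, s.1; split=> // x Bx; exists 0%N => f sf Gf.
have := Gbounded (sG _ sg) Bx; have := Gbounded Gf Bx.
by rewrite !ler_norml; lra.
Qed.

Lemma level_has_inf i s : admissible i s ->
  has_inf (level_set s.1 s.2 (r ^+ i)).
Proof.
move=> as_; split; first by exists 2; exact: level_set_nonempty as_.
by exists th; exact: level_set_ge as_.
Qed.

Lemma level_ge i s : admissible i s -> th <= level s.1 s.2 (r ^+ i).
Proof.
move=> as_; apply: lb_le_inf (level_set_ge as_).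
by exists 2; exact: level_set_nonempty as_.
Qed.

Lemma level_le2 i s : admissible i s -> level s.1 s.2 (r ^+ i) <= 2.
Proof.
move=> as_; apply: ge_inf (level_set_nonempty as_).
by case: (level_has_inf as_).
Qed.

(** The last two clauses squeeze the level: the upper bound holds at every point but only for late
    functions, the lower one at a single point but for every function kept. *)
Definition step_spec i (e : R) (s s' : set (E -> R) * (E -> R)) (g : E -> R) :=
  [/\ s.1 g, s'.1 `<=` s.1,
      s'.2 = (fun x => s.2 x + (1 - r) * r ^+ i * g x),
      eventual_ub s'.1 (fun x => s.2 x + r ^+ i * g x)
        (level s.1 s.2 (r ^+ i) + e) &
      exists2 x, B x & forall f, s'.1 f ->
        level s.1 s.2 (r ^+ i) - e <= s.2 x + r ^+ i * g x - f x].

Lemma step_exists i e s : 0 < e -> admissible i s ->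
  exists s' g, admissible i.+1 s' /\ step_spec i e s s' g.
Proof.
move=> e0 as_; have [cs ls sGi sG] := as_.
have [a [g [D [sg Ds cD lD ub]]] alt] := inf_adherent e0 (level_has_inf as_).
(* By minimality [L - e] is not an eventual bound for [D], which yields the point
   [x] used to cut [D] down while keeping it large. *)
rewrite -/(level _ _ _) in alt; set L := level _ _ _ in alt *.
have : ~ eventual_ub D (fun x => s.2 x + r ^+ i * g x) (L - e).
  move=> ub'; have : L <= L - e.
    apply: ge_inf; first by case: (level_has_inf as_).
    by exists g, D.
  by lra.
move=> /existsNP[x /not_implyP[Bx /forallNP nub]].
have Dx N : exists f, [/\ D f, G N f & L - e < s.2 x + r ^+ i * g x - f x].
  have /existsNP[f /not_implyP[Df /not_implyP[Gf /negP lt]]] := nub N.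
  by exists f; split=> //; rewrite ltNge.
exists ([set f | [/\ D f, G i.+1 f & L - e <= s.2 x + r ^+ i * g x - f x]],
  fun x => s.2 x + (1 - r) * r ^+ i * g x), g.
split; last first.
  split=> //=.
  - by move=> f [/Ds].
  - move=> y By; have [N ubN] := ub y By; exists N => f [Df _ _] Gf.
    by rewrite (le_trans (ubN f Df Gf))// ltW.
  - by exists x => // f [].
split=> /=.
- move=> f f' t [Df Gf fx] [Df' Gf' fx'] t01; split; [exact: cD|exact: Gconvex|].
  have -> : s.2 x + r ^+ i * g x - (t * f x + (1 - t) * f' x) =
      t * (s.2 x + r ^+ i * g x - f x) + (1 - t) * (s.2 x + r ^+ i * g x - f' x).
    by ring.
  exact: convex_ge.
- move=> N; have [f [Df Gf fx]] := Dx (maxn N i.+1).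
  exists f; split; last by apply: Gdecr Gf; rewrite leq_maxl.
  split=> //; last exact: ltW.
  by apply: Gdecr Gf; rewrite leq_maxr.
- by move=> f [].
- move=> f [/Ds sf _ _].
  (* Since [r^i = (1 - r) r^i + r^(i+1)], fixing [g] and continuing with [f] amounts to the single
     choice [r f + (1 - r) g], which convexity allows. *)
  have -> : (fun y => s.2 y + (1 - r) * r ^+ i * g y + r ^+ i.+1 * f y) =
    (fun y => s.2 y + r ^+ i * (r * f y + (1 - r) * g y)).
    by apply/funext => y; rewrite exprS; ring.
  by apply: (sG (fun y => r * f y + (1 - r) * g y)); exact: cs.
Qed.

(** A choice [f] for the later state is the choice [r f + (1 - r) g] for the earlier one, with the
    same [D], so the later level set is contained in the earlier. *)
Lemma level_step i e s s' g : admissible i s -> admissible i.+1 s' ->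
  step_spec i e s s' g -> level s.1 s.2 (r ^+ i) <= level s'.1 s'.2 (r ^+ i.+1).
Proof.
move=> as_ as' [sg s's ps' _ _]; have [cs _ _ _] := as_.
apply: lb_le_inf; first by exists 2; exact: level_set_nonempty as'.
move=> a [f [D [s'f Ds' cD lD ub]]].
apply: ge_inf; first by case: (level_has_inf as_).
exists (fun y => r * f y + (1 - r) * g y), D; split=> //.
- by apply: cs => //; exact: s's.
- exact: subset_trans s's.
- have -> : (fun x => s.2 x + r ^+ i * (r * f x + (1 - r) * g x)) =
      (fun x => s'.2 x + r ^+ i.+1 * f x).
    by apply/funext => x; rewrite ps' exprS; ring.
  exact: ub.
Qed.

Lemma states_exist (e : nat -> R) : (forall i, 0 < e i) ->
  exists (s : nat -> set (E -> R) * (E -> R)) (g : nat -> E -> R),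
    s 0%N = (G 0, fun=> 0) /\
    forall i, admissible i (s i) /\ step_spec i (e i) (s i) (s i.+1) (g i).
Proof.
move=> e0.
have ex i s : exists s'g, admissible i s ->
    admissible i.+1 s'g.1 /\ step_spec i (e i) s s'g.1 s'g.2.
  (* Outside admissible states the pair is arbitrary; it only makes the choice total. *)
  have [as_|] := pselect (admissible i s); last by exists (s, s.2).
  by have [s' [g]] := step_exists (e0 i) as_; exists (s', g).
pose F i s := projT1 (cid (ex i s)).
have FP i s : admissible i s ->
    admissible i.+1 (F i s).1 /\ step_spec i (e i) s (F i s).1 (F i s).2.
  by rewrite /F; case: cid.
pose s := fix s i := if i is i'.+1 then (F i' (s i')).1 else (G 0, fun=> 0 : R).
have sP i : admissible i (s i).
  elim: i => [|i IH] /=; last by case: (FP _ _ IH).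
  split=> //=.
    by move=> N; have [f Gf] := Gnonempty N; exists f; split=> //; exact: Gdecr Gf.
  move=> g Gg; suff -> : (fun x => 0 + r ^+ 0 * g x) = g by [].
  by apply/funext => x; rewrite expr0 mul1r add0r.
exists s, (fun i => (F i (s i)).2); split=> // i; split; first exact: sP.
by case: (FP _ _ (sP i)).
Qed.

Lemma le_geometric_error (a m K : R) i :
  (forall j, (i <= j)%N -> a <= m + K * r ^+ j) -> a <= m.
Proof.
move=> aK; have cvgr : (m + K * r ^+ j) @[j --> \oo] --> m + K * 0.
  apply: cvgD; first exact: cvg_cst.
  apply: cvgM; first exact: cvg_cst.
  by apply: cvg_expr; case/andP: r01 => r0 r1; rewrite gtr0_norm.
rewrite -[m]addr0 -(mulr0 K); apply: (cvgr_to_ge cvgr).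
by exists i => // j /= ij; exact: aK.
Qed.

(* [kap] absorbs the errors [e i] of the approximate minimizations. *)
Lemma no_max (kap : R) : 0 < kap -> kap + 2 * r < th ->
  exists p g : nat -> E -> R,
  [/\ p 0%N = (fun=> 0),
      forall i, p i.+1 = (fun x => p i x + (1 - r) * r ^+ i * g i x),
      forall i, G i (g i) &
      forall h w : E -> R, (forall x, B x -> between (p^~ x) (h x)) ->
        (forall x, B x -> between (g^~ x) (w x)) ->
        forall x, B x -> exists2 y, B y & h x - w x < h y - w y].
Proof.
move=> kap0 kapth; have [r0 r1] := andP r01.
(* Divided by [r ^+ i.+1], these errors are [kap / 2^(i+1)], with sum [kap]; this closes the
   induction for [Px]. *)
pose e i := kap * r ^+ i.+1 * 2^-1 ^+ i.+1.
have rn i : 0 < r ^+ i by rewrite exprn_gt0.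
have hn i : 0 < 2^-1 ^+ i :> R by rewrite exprn_gt0// invr_gt0.
have e0 i : 0 < e i by rewrite !mulr_gt0.
have [s [g [s0 sP]]] := states_exist e0.
have sA i : admissible i (s i) by case: (sP i).
pose p i := (s i).2; pose a i := level (s i).1 (s i).2 (r ^+ i).
have pS i : p i.+1 = (fun x => p i x + (1 - r) * r ^+ i * g i x).
  by case: (sP i) => _ [].
have Gg i : G i (g i) by case: (sP i) => [[_ _ sub _] [/sub]].
have gb i x : B x -> `|g i x| <= 1.
  by move=> Bx; apply: Gbounded => //; apply: Gdecr (Gg i).
have sdecr i j : (i <= j)%N -> (s j).1 `<=` (s i).1.
  elim: j => [|j IH]; first by rewrite leqn0 => /eqP->.
  rewrite leq_eqVlt => /orP[/eqP->//|/IH]; apply: subset_trans.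
  by case: (sP j) => _ [].
have amono i j : (i <= j)%N -> a i <= a j.
  elim: j => [|j IH]; first by rewrite leqn0 => /eqP->.
  rewrite leq_eqVlt => /orP[/eqP->//|/IH/le_trans]; apply.
  by apply: level_step (sA j) (sA j.+1) (proj2 (sP j)).
pose A := sup (range a).
have aA i : a i <= A.
  apply: sup_upper_bound; last by exists i.
  split; first by exists (a i); exists i.
  by exists 2 => _ [j _ <-]; apply: level_le2.
have thA : th <= A by apply: le_trans (aA 0%N); apply: level_ge.
exists p, g; split=> //; first by rewrite /p s0.
move=> h w hp wg x Bx; apply: contrapT => /forallPNP nlt.
have {}nlt y : B y -> h y - w y <= h x - w x.
  by move=> By; rewrite leNgt; apply/negP/nlt.
have pp y i j : B y -> (i <= j)%N ->
    `|p j y - p i y| <= r ^+ i - r ^+ j.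
  move=> By; elim: j => [|j IH].
    by rewrite leqn0 => /eqP->; rewrite !subrr normr0.
  rewrite leq_eqVlt => /orP[/eqP->|/IH {}IH]; first by rewrite !subrr normr0.
  rewrite pS addrAC (le_trans (ler_normD _ _))//.
  have : `|(1 - r) * r ^+ j * g j y| <= (1 - r) * r ^+ j.
    rewrite normrM ger0_norm; last by rewrite mulr_ge0 ?subr_ge0 ?ltW.
    by rewrite ler_piMr ?gb// mulr_ge0 ?subr_ge0 ?ltW.
  by rewrite exprS; lra.
have hpi i y : B y -> p i y - r ^+ i <= h y <= p i y + r ^+ i.
  move=> By; have pj j : (i <= j)%N ->
      p i y - r ^+ i <= p j y <= p i y + r ^+ i.
    by move=> ij; have := pp y i j By ij; have := rn j; rewrite ler_norml; lra.
  by apply/andP; split; [apply: (proj1 (hp y By _ i))|apply: (proj2 (hp y By _ i))]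
     => j /pj/andP[].
have wb y : B y -> -1 <= w y.
  move=> By; apply: (proj1 (wg y By _ 0%N)) => j _.
  by have := gb j y By; rewrite ler_norml => /andP[].
(* The cut point [y] of stage [j] gives [h y - w y >= a j - (kap + 2) r^j]; maximality transfers
   this to [x], and [j] tends to infinity. *)
have Am : A <= h x - w x.
  apply: ge_sup; first by exists (a 0%N); exists 0%N.
  move=> _ [i _ <-]; apply: (@le_geometric_error _ _ (kap + 2) i) => j ij.
  have [y By lb] : exists2 y, B y & forall f, (s j.+1).1 f ->
      a j - e j <= p j y + r ^+ j * g j y - f y by case: (sP j) => _ [].
  have wy : w y <= p j y + r ^+ j * g j y - (a j - e j).
    apply: (proj2 (wg y By _ j.+1)) => k jk.
    have : (s j.+1).1 (g k) by apply: (sdecr _ _ jk); case: (sP k) => _ [].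
    by move=> /lb; lra.
  have := hpi j y By; have := nlt y By; have := amono _ _ ij.
  have : r ^+ j * g j y <= r ^+ j.
    by rewrite ler_piMr ?(ltW (rn _))//; have := gb j y By; rewrite ler_norml => /andP[].
  have : e j <= kap * r ^+ j.
    rewrite /e -mulrA ler_wpM2l ?(ltW kap0)// exprS.
    have : 2^-1 ^+ j.+1 <= 1 :> R by rewrite exprn_ile1//; lra.
    move: (2^-1 ^+ j.+1) (hn j.+1) => q q0 q1.
    have rj := rn j; rewrite -mulrA -[leRHS]mul1r.
    apply: ler_pM; [exact: ltW|by rewrite mulr_ge0 ?ltW|exact: ltW|].
    by rewrite ler_piMr// ltW.
  by lra.
(* The left side is [sum_(j < i) (1 - r) r^j (g j x - w x)]; the eventual upper bounds on
   [p i + r^i g i - w] control it recursively. *)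
have Px i : p i x - (1 - r ^+ i) * w x <=
    A * (1 - r ^+ i) + kap * r ^+ i * (1 - 2^-1 ^+ i).
  elim: i => [|i IH]; first by rewrite /p s0 !expr0 !subrr/=; lra.
  have hq : p i x + r ^+ i * g i x - w x <= A + e i.
    have [_ [_ _ _ ub _]] := sP i; have [N ubx] := ub x Bx.
    have : p i x + r ^+ i * g i x - (A + e i) <= w x.
      apply: (proj1 (wg x Bx _ (maxn N i.+1))) => k; rewrite geq_max => /andP[Nk ik].
      have sk : (s i.+1).1 (g k) by apply: (sdecr _ _ ik); case: (sP k) => _ [].
      have := ubx (g k) sk (Gdecr Nk (Gg k)); have := aA i.
      by rewrite /a /p; lra.
    by lra.
  have -> : p i.+1 x - (1 - r ^+ i.+1) * w x = r * (p i x - (1 - r ^+ i) * w x) +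
      (1 - r) * (p i x + r ^+ i * g i x - w x) by rewrite pS exprS; ring.
  have -> : A * (1 - r ^+ i.+1) + kap * r ^+ i.+1 * (1 - 2^-1 ^+ i.+1) =
      r * (A * (1 - r ^+ i) + kap * r ^+ i * (1 - 2^-1 ^+ i)) +
      ((1 - r) * A + e i).
    by rewrite /e !exprS; move: (2^-1 ^+ i) => q; field.
  rewrite lerD ?ler_pM2l//.
  apply: (@le_trans _ _ ((1 - r) * (A + e i))); first by rewrite ler_pM2l// subr_gt0.
  by rewrite mulrDr lerD2l ler_piMl ?(ltW (e0 i))// gerBl ltW.
pose c := th - kap - 2 * r.
(* Compare [A <= h x - w x] with the bound [Px i] on the first [i] terms: the
   [i]-th term must contribute, since the later ones add at most [2 r^(i+1)]. *)
have gw i : w x + c <= g i x.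
  have := Px i; have := hpi i.+1 x Bx; have := wb x Bx; rewrite pS => wx /andP[_ hx] Pi.
  have : r ^+ i * c <= r ^+ i * ((1 - r) * (g i x - w x)).
    have : kap * r ^+ i * (1 - 2^-1 ^+ i) <= kap * r ^+ i.
      by rewrite ler_piMr ?mulr_ge0 ?(ltW (rn _)) ?(ltW kap0)// gerBl ltW.
    have : r ^+ i * th <= r ^+ i * A by rewrite ler_pM2l.
    have : r ^+ i.+1 * -1 <= r ^+ i.+1 * w x by rewrite ler_pM2l.
    by move: hx Pi Am; rewrite /c exprS; lra.
  rewrite ler_pM2l// => cg; have c0 : 0 < c by rewrite /c; lra.
  have gw0 : 0 < g i x - w x.
    by rewrite -(pmulr_rgt0 _ (_ : 0 < 1 - r)) ?subr_gt0// (lt_le_trans c0).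
  rewrite addrC -lerBrDr (le_trans cg)//.
  by rewrite ler_piMl ?(ltW gw0)// gerBl ltW.
have : w x + c <= w x by apply: (proj1 (wg x Bx _ 0%N)).
by rewrite /c; lra.
Qed.

End Core.

(** * Ultrafilter limits and an approximate Helly theorem *)

Lemma fmap_ultra (T S : Type) (f : T -> S) (U : set_system T) :
  UltraFilter U -> UltraFilter (f @ U).
Proof.
move=> UU; split; first exact: fmap_proper_filter.
move=> G PG UG; apply/seteqP; split=> // A GA.
have [//|UnA] := in_ultra_setVsetC (f @^-1` A) UU.
have GnA : G (~` A) by apply: UG.
by have [x []] := filter_ex (filterI GA GnA).
Qed.

(** One ultrafilter containing all tails serves every bounded sequence, so that limits along it will
    be linear in the sequence; compactness of [[-M, M]] gives convergence. *)
Lemma ultrafilter_limit (R : realType) : exists U : set_system nat,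
  ProperFilter U /\ forall (u : nat -> R) (M : R), (forall n, `|u n| <= M) ->
    exists l, u @ U --> l /\ between u l.
Proof.
have [U [UU oU]] := @ultraFilterLemma nat \oo _.
have PU : ProperFilter U by exact: ultra_proper.
exists U; split=> //.
move=> u M uM.
have cM := @segment_compact R (- M) M; rewrite compact_ultra in cM.
have uE n : (u @^-1` [set` `[- M, M]]) n by rewrite /= in_itv/= -ler_norml.
have uU : (u @ U) [set` `[- M, M]] by exact: (filterS (fun n _ => uE n) (filterT : U setT)).
have [l [_ ul]] := cM (u @ U) (fmap_ultra u UU) uU.
exists l; split=> // c J; split=> cu.
  apply: (cvgr_to_ge ul); apply: oU; exists J => // j; exact: cu.
apply: (cvgr_to_le ul); apply: oU; exists J => // j; exact: cu.
Qed.

(* The infimum over [B] of the sum of the [(u j x - c j) ^+ 2] is [0]: otherwise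
   moving a near-minimizer [x] towards the [y] given by the separation hypothesis
   for the coefficients [c j - u j x] would decrease the sum below it. *)
Lemma approximate_helly (R : realType) (E : Type) (B : set E) n
    (u : 'I_n -> E -> R) (c : 'I_n -> R) (M : R) :
  (forall x y t, B x -> B y -> 0 <= t <= 1 ->
    exists2 z, B z & forall j, u j z = (1 - t) * u j x + t * u j y) ->
  (forall j x, B x -> `|u j x| <= M) ->
  (forall a e, 0 < e -> exists2 y, B y &
    \sum_j a j * c j - e <= \sum_j a j * u j y) ->
  forall e, 0 < e -> exists2 x, B x & forall j, `|u j x - c j| <= e.
Proof.
move=> cB bB sep e e0.
pose Q x := \sum_j (u j x - c j) ^+ 2; pose S := Q @` B.
have Q0 x : 0 <= Q x by apply: sumr_ge0 => j _; rewrite sqr_ge0.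
have S0 : S !=set0.
  by have [y By _] := sep (fun=> 0) 1 ltr01; exists (Q y); exists y.
have infS : has_inf S by split=> //; exists 0 => _ [x _ <-].
pose K := \sum_j (M + `|c j|) ^+ 2.
have QK x : B x -> Q x <= K.
  move=> Bx; apply: ler_sum => j _.
  rewrite -[leLHS]real_normK ?num_real// ler_sqr ?nnegrE//; last first.
    by rewrite addr_ge0// (le_trans _ (bB j x Bx)).
  by rewrite (le_trans (ler_normB _ _))// lerD2r bB.
have d0 : 0 <= inf S by apply: lb_le_inf => // _ [x _ <-].
suff d_le0 : inf S <= 0.
  have [|_ [x Bx <-] Qx] := @inf_adherent _ _ (e ^+ 2) _ infS.
    by rewrite exprn_gt0.
  exists x => // j; rewrite -ler_sqr ?nnegrE ?(ltW e0)// real_normK ?num_real//.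
  rewrite (le_trans _ (_ : Q x <= _))//; last by lra.
  by rewrite /Q (bigD1 j)//= lerDl sumr_ge0// => k _; rewrite sqr_ge0.
rewrite leNgt; apply/negP => {}d0; set d := inf S in d0 *.
have K0 : 0 <= K by apply: sumr_ge0 => j _; rewrite sqr_ge0.
(* This [t] satisfies [t (d + 3 + K) = d], which reduces the final bound on [Q z] to
   [d - t d - 2 t^2 - t^4 < d]. *)
pose t := d / (d + 3 + K).
have D0 : 0 < d + 3 + K by lra.
have t0 : 0 < t by rewrite divr_gt0.
have t1 : t < 1 by rewrite ltr_pdivrMr//; lra.
have tt0 : 0 < t ^+ 2 by rewrite exprn_gt0.
have [_ [x Bx <-]] := inf_adherent tt0 infS; rewrite -/d => Qx.
have [y By] := sep (fun j => - (u j x - c j)) _ tt0; move=> xy.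
have {}xy : \sum_j (u j x - c j) * (u j y - c j) <= t ^+ 2.
  rewrite -subr_ge0; move: xy; rewrite -subr_ge0 => /le_trans; apply.
  rewrite le_eqVlt; apply/orP; left; apply/eqP.
  rewrite opprB addrCA; congr (_ + _); rewrite -sumrB -sumrN.
  by apply: eq_bigr => j _; ring.
have [|z Bz zE] := cB x y t Bx By; first by rewrite !ltW.
have Qz : Q z = (1 - t) ^+ 2 * Q x +
    2 * t * (1 - t) * (\sum_j (u j x - c j) * (u j y - c j)) + t ^+ 2 * Q y.
  rewrite /Q !mulr_sumr -!big_split/=; apply: eq_bigr => j _.
  by rewrite zE; ring.
have dz : d <= Q z by apply: ge_inf; [case: infS|exists z].
have : d <= (1 - t) ^+ 2 * (d + t ^+ 2) + 2 * t * (1 - t) * t ^+ 2 + t ^+ 2 * K.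
  apply: (le_trans dz); rewrite Qz; apply: lerD; last by rewrite ler_pM2l// QK.
  apply: lerD.
    by rewrite ler_wpM2l ?sqr_ge0// ltW.
  by rewrite ler_wpM2l// mulr_ge0 ?subr_ge0 ?(ltW t1)// mulr_ge0// ltW.
have tD : t * (d + 3 + K) = d by rewrite /t divfK ?gt_eqF.
have -> : (1 - t) ^+ 2 * (d + t ^+ 2) + 2 * t * (1 - t) * t ^+ 2 + t ^+ 2 * K =
    d - 2 * (t * d) + t * (t * (d + 3 + K)) - 2 * t ^+ 2 - (t ^+ 2) ^+ 2 by ring.
rewrite tD; have : 0 < t * d by rewrite mulr_gt0.
by have := sqr_ge0 (t ^+ 2); lra.
Qed.

(** * Hahn-Banach for complex normed spaces *)

Definition rnorm (R : realType) (X : normedModType R[i]) (x : X) : R :=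
  complex.Re `|x|.

Section RealNorm.
Variables (R : realType) (X : normedModType R[i]).
Implicit Types x y : X.

Lemma rnormE x : (rnorm x)%:C = `|x|.
Proof. by rewrite /rnorm RRe_real// normr_real. Qed.

Lemma rnorm_ge0 x : 0 <= rnorm x. Proof. by rewrite -ler0c rnormE. Qed.

Lemma rnorm_gt0 x : x <> 0 -> 0 < rnorm x.
Proof. by move=> /eqP; rewrite -normr_gt0 -rnormE -[0]/(0%:C) ltcR. Qed.

Lemma rnormZ (a : R[i]) x : (rnorm (a *: x))%:C = `|a| * (rnorm x)%:C.
Proof. by rewrite !rnormE normrZ. Qed.

Lemma rnormZR (t : R) x : rnorm (t%:C *: x) = `|t| * rnorm x.
Proof.
apply: (@complexI R).
by rewrite rnormZ rmorphM/= normc_def/= expr0n/= addr0 sqrtr_sqr.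
Qed.

Lemma rnormD x y : rnorm (x + y) <= rnorm x + rnorm y.
Proof. by rewrite -lecR rmorphD/= !rnormE ler_normD. Qed.

Lemma rnormN x : rnorm (- x) = rnorm x. Proof. by rewrite /rnorm normrN. Qed.

End RealNorm.

Section HahnBanach.
Variables (R : realType) (X : lmodType R[i]).

Definition real_linear (u : X -> R) :=
  (forall x y, u (x + y) = u x + u y) /\ (forall t x, u (t%:C *: x) = t * u x).

Definition sublinear (q : X -> R) :=
  (forall x y, q (x + y) <= q x + q y) /\
  (forall t x, 0 <= t -> q (t%:C *: x) = t * q x).

Lemma sublinear0 q : sublinear q -> q 0 = 0.
Proof. by move=> [_ qZ]; rewrite -(scaler0 _ 0%:C) qZ// mul0r. Qed.

Lemma sublinearN q x : sublinear q -> - q (- x) <= q x.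
Proof.
move=> sq; have [qD _] := sq.
by rewrite lerNl -subr_ge0 opprK addrC -[leLHS](sublinear0 sq) -(subrr x).
Qed.

Section Push.
Variables (q : X -> R) (x : X).
Hypothesis sq : sublinear q.

Let push_set y := [set q (y + t%:C *: x) - t * q x | t in [set t | 0 <= t]].

(* The largest sublinear minorant of [q] whose value at [- x] is at most [- q x]. *)
Definition push y := inf (push_set y).

Let push_inf y : has_inf (push_set y).
Proof.
split; first by exists (q (y + 0%:C *: x) - 0 * q x); exists 0; rewrite /=.
exists (- q (- y)) => _ [t /= t0 <-]; have [qD qZ] := sq.
rewrite -qZ//; have := qD (y + t%:C *: x) (- y).
by rewrite addrAC subrr add0r; lra.
Qed.

Lemma push_le_at y t : 0 <= t -> push y <= q (y + t%:C *: x) - t * q x.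
Proof. by move=> t0; apply: ge_inf; [case: (push_inf y)|exists t]. Qed.

Lemma push_ge y c : (forall t, 0 <= t -> c <= q (y + t%:C *: x) - t * q x) ->
  c <= push y.
Proof.
by move=> cP; apply: lb_le_inf; [case: (push_inf y)|move=> _ [t /= t0 <-]; exact: cP].
Qed.

Lemma push_le y : push y <= q y.
Proof. by have := push_le_at y (lexx 0); rewrite scale0r addr0 mul0r subr0. Qed.

Lemma pushN : push (- x) <= - q x.
Proof.
by have := push_le_at (- x) ler01; rewrite scale1r addNr (sublinear0 sq) mul1r sub0r.
Qed.

Lemma push_sublinear : sublinear push.
Proof.
have [qD qZ] := sq; split=> [y z|s y].
  rewrite -lerBlDr; apply: push_ge => t t0; rewrite lerBlDr [leRHS]addrC -lerBlDr.
  apply: push_ge => t' t'0; rewrite lerBlDr.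
  have := push_le_at (y + z) (addr_ge0 t0 t'0).
  rewrite rmorphD/= scalerDl addrACA mulrDl.
  by have := qD (y + t%:C *: x) (z + t'%:C *: x); lra.
have le r z : 0 < r -> push (r%:C *: z) <= r * push z.
  move=> r0; rewrite -ler_pdivrMl//; apply: push_ge => t t0.
  rewrite ler_pdivrMl//; have rt0 : 0 <= r * t by rewrite mulr_ge0// ltW.
  apply: (le_trans (push_le_at _ rt0)).
  by rewrite rmorphM/= -scalerA -scalerDr qZ ?(ltW r0)// mulrBr mulrA.
rewrite le_eqVlt => /predU1P[<-|s0].
  rewrite scale0r mul0r; apply/le_anti; rewrite -{1}(sublinear0 sq) push_le/=.
  by apply: push_ge => t t0; rewrite add0r qZ// subrr.
apply/le_anti; rewrite le//= -ler_pdivlMl//.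
apply: (le_trans _ (le s^-1 (s%:C *: y) _)); last by rewrite invr_gt0.
by rewrite scalerA -rmorphM/= mulVf ?gt_eqF// scale1r.
Qed.

End Push.

(** Minimality forces [push q x = q], and [push q x y <= q (y + x) - q x] then turns subadditivity
    into additivity. *)
Lemma minimal_sublinear_linear q : sublinear q ->
  (forall q', sublinear q' -> (forall x, q' x <= q x) -> q' = q) -> real_linear q.
Proof.
move=> sq min; have [qD qZ] := sq.
have qDE x y : q (x + y) = q x + q y.
  have pq : push q x = q by apply: min; [exact: push_sublinear|exact: push_le].
  have := push_le_at x sq y ler01; rewrite pq scale1r mul1r [y + x]addrC.
  by have := qD x y; lra.
have qN x : q (- x) = - q x.
  by apply/eqP; rewrite -addr_eq0 -qDE addNr sublinear0.
split=> // t x; have [t0|t0] := leP 0 t; first exact: qZ.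
rewrite -[t]opprK rmorphN/= scaleNr qN qZ ?mulNr//.
by rewrite oppr_ge0 ltW.
Qed.

(** Zorn's lemma on the sublinear minorants of [p], ordered downwards; a nonempty chain is bounded
    by its pointwise infimum, the empty one by [p]. *)
Lemma minimal_sublinear_exists p : sublinear p -> exists2 q,
  sublinear q /\ (forall x, q x <= p x) &
  forall q', sublinear q' -> (forall x, q' x <= q x) -> q' = q.
Proof.
move=> sp; pose T := {q | sublinear q /\ forall x, q x <= p x}.
have [||||[q [sq qp]] qmin] := @Zorn T (fun a b => `[< forall x, sval b x <= sval a x >]).
- by move=> a; apply/asboolP.
- move=> a b c /asboolP ab /asboolP bc; apply/asboolP => x.
  exact: le_trans (bc x) (ab x).
- move=> a b /asboolP ab /asboolP ba; apply: eq_sig_hprop => [?|].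
    exact: Prop_irrelevance.
  by apply/funext => x; apply/le_anti; rewrite ab ba.
- move=> A tA; have [[a0 Aa0]|/set0P/negP/negPn/eqP A0] := pselect (A !=set0); last first.
    by exists (exist _ p (conj sp (fun x => lexx _))) => s; rewrite A0.
  pose S x := [set sval a x | a in A].
  have infS x : has_inf (S x).
    split; first by exists (sval a0 x); exists a0.
    exists (- p (- x)) => _ [a _ <-]; have [sa ap] := svalP a.
    by apply: le_trans (sublinearN x sa); rewrite lerN2.
  have le_at a x : A a -> inf (S x) <= sval a x.
    by move=> Aa; apply: ge_inf; [case: (infS x)|exists a].
  have ge x c : (forall a, A a -> c <= sval a x) -> c <= inf (S x).
    by move=> ca; apply: lb_le_inf; [case: (infS x)|move=> _ [a Aa <-]; exact: ca].
  have sS : sublinear (fun x => inf (S x)).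
    split=> [x y|t x t0].
      rewrite -lerBlDr; apply: (ge) => a Aa; rewrite lerBlDr [leRHS]addrC -lerBlDr.
      apply: (ge) => b Ab; rewrite lerBlDr.
      have [c [Ac ca cb]] : exists c, [/\ A c, sval c x <= sval a x & sval c y <= sval b y].
        by have [/asboolP ab|/asboolP ba] := tA a b Aa Ab; [exists b|exists a].
      have sD : sval c (x + y) <= sval c x + sval c y.
        by have [[cD _] _] := svalP c; exact: cD.
      by have := le_at c (x + y) Ac; lra.
    have sv (a : T) (z : X) r : 0 <= r -> sval a (r%:C *: z) = r * sval a z.
      by have [[_ aZ] _] := svalP a; exact: aZ.
    move: t0; rewrite le_eqVlt => /predU1P[<-|t0].
      rewrite mul0r; apply/le_anti/andP; split.
        by rewrite (le_trans (le_at a0 _ Aa0))// sv// mul0r.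
      by apply: (ge) => a Aa; rewrite sv// mul0r.
    apply/le_anti/andP; split.
      rewrite -ler_pdivrMl//; apply: (ge) => a Aa; rewrite ler_pdivrMl//.
      by rewrite -sv ?(ltW t0)//; exact: le_at.
    by apply: (ge) => a Aa; rewrite sv ?(ltW t0)// ler_pM2l//; exact: le_at.
  have Sp x : inf (S x) <= p x.
    by apply: (le_trans (le_at a0 x Aa0)); have [] := svalP a0.
  exists (exist (fun q => sublinear q /\ forall x, q x <= p x) _ (conj sS Sp)).
  by move=> a Aa; apply/asboolP => x /=; exact: le_at.
- exists q => // q' sq' q'q.
  have q'p x : q' x <= p x by apply: le_trans (qp x).
  have := qmin (exist (fun q => sublinear q /\ forall x, q x <= p x) _ (conj sq' q'p)).
  by move/(_ (introT (asboolP _) q'q)) => [].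
Qed.

End HahnBanach.

Lemma rnorm_sublinear (R : realType) (X : normedModType R[i]) :
  sublinear (@rnorm R X).
Proof.
by split=> [x y|t x t0]; [exact: rnormD|rewrite rnormZR ger0_norm].
Qed.

(** A minimal sublinear function below [push rnorm x] is linear and at most [- rnorm x] at [- x];
    lying below the norm, it equals the norm at [x]. *)
Lemma norming_functional (R : realType) (X : normedModType R[i]) (x : X) :
  exists u, [/\ real_linear u, forall y, `|u y| <= rnorm y & u x = rnorm x].
Proof.
have sn := rnorm_sublinear X; have sp := push_sublinear x sn.
have [q [sq qp] qmin] := minimal_sublinear_exists sp.
have ql := minimal_sublinear_linear sq qmin; have [qD qZ] := ql.
have qn y : q y <= rnorm y by apply: le_trans (qp y) (push_le _ sn _).
have qN y : q (- y) = - q y.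
  by apply/eqP; rewrite -addr_eq0 -qD addNr sublinear0.
exists q; split=> //.
  by move=> y; rewrite ler_norml qn andbT lerNl -qN -(rnormN y) qn.
apply/le_anti; rewrite qn/= -lerN2 -qN.
exact: le_trans (qp _) (pushN x sn).
Qed.

(** * Real and complex functionals on a normed space *)

Section Functionals.
Variables (R : realType) (X : normedModType R[i]).

Lemma rnorm_dual (f : topdual X) : rnorm f = opnorm f.
Proof. by []. Qed.

Lemma real_linear_Re (f : topdual X) : real_linear (fun x => complex.Re (f x)).
Proof.
split=> [x y|t x]; first by rewrite linearD raddfD.
by rewrite linearZ /=; case: (f x) => a b /=; rewrite mul0r subr0.
Qed.

Lemma real_linear_sum n (u : X -> R) (a : 'I_n -> R) (v : 'I_n -> X) :
  real_linear u -> u (\sum_j (a j)%:C *: v j) = \sum_j a j * u (v j).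
Proof.
move=> [uD uZ]; apply: (big_ind2 (fun x r => u x = r)) => //.
- by rewrite -(scaler0 _ 0%:C) uZ mul0r.
- by move=> x r y s <- <-.
Qed.

Lemma Re_functional_le (f : topdual X) x :
  `|complex.Re (f x)| <= opnorm f * rnorm x.
Proof.
rewrite -lecR rmorphM/= rnormE; apply: le_trans (ler_opnorm f x).
exact: normc_ge_Re.
Qed.

Lemma unit_rotation (z : R[i]) : exists2 c : R[i], `|c| = 1 & c * z = `|z|.
Proof.
have [->|z0] := eqVneq z 0; first by exists 1; rewrite ?normr1// mulr0 normr0.
exists (`|z| / z); last by rewrite divfK.
by rewrite normf_div normr_id divff// normr_eq0.
Qed.

Lemma Re_functional_sup (f : topdual X) e : 0 < e ->
  exists2 x, rnorm x <= 1 & opnorm f - e <= complex.Re (f x).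
Proof.
move=> e0; have [_ [x /= x1 <-] lt] := sup_adherent e0 (opnorm_has_sup f).
have [c c1 cf] := unit_rotation (f x).
exists (c *: x); last by rewrite linearZ/= [_ *: _]cf ltW.
by rewrite -lecR rnormE normrZ c1 mul1r.
Qed.

(** The functional is [u x - i u (i x)]; the bound survives because a unit scalar [c] gives
    [|f x| = u (c x)]. *)
Lemma complexify (u : X -> R) (M : R) : real_linear u -> 0 <= M ->
  (forall x, `|u x| <= M * rnorm x) ->
  exists2 f : topdual X, forall x, complex.Re (f x) = u x & opnorm f <= M.
Proof.
move=> [uD uZ] M0 uM.
pose f (x : X) : R[i]^o := (u x)%:C - 'i%C * (u ('i%C *: x))%:C.
have ReE x : complex.Re (f x) = u x by rewrite /f /=; ring.
have uN x : u (- x) = - u x.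
  by rewrite -scaleN1r -[-1](rmorphN1 (real_complex R)) uZ mulN1r.
have fD x y : f (x + y) = f x + f y.
  by rewrite /f scalerDr !uD !rmorphD/=; ring.
have fZR t x : f (t%:C *: x) = t%:C * f x.
  by rewrite /f scalerA ['i%C * t%:C]mulrC -scalerA !uZ !rmorphM/=; ring.
have fZi x : f ('i%C *: x) = 'i%C * f x.
  rewrite /f scalerA -expr2 sqr_i scaleN1r uN rmorphN/=.
  by rewrite mulrBr mulrA -expr2 sqr_i; ring.
have fZ a x : f (a *: x) = a * f x.
  by rewrite [a]complexE scalerDl fD fZR -scalerA fZi fZR; ring.
have fL : linear f by move=> a x y; rewrite fD fZ.
have fM x : `|f x| <= M%:C * `|x|.
  have [c c1 cf] := unit_rotation (f x).
  have cx : u (c *: x) = rnorm (f x) by rewrite -ReE fZ cf.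
  rewrite -!rnormE -rmorphM lecR -cx.
  have := uM (c *: x); rewrite ler_norml => /andP[_ /le_trans]; apply.
  by rewrite ler_wpM2l// -lecR !rnormE normrZ c1 mul1r.
have fP : f \in @bounded_linear R X R[i]^o by apply/asboolP; split=> //; exists M.
exists (BLinOp fP) => //=; exact: opnorm_le.
Qed.

Lemma ball_helly n (u : 'I_n -> X -> R) (c : 'I_n -> R) (M : R) :
  (forall j, real_linear (u j)) ->
  (forall j x, rnorm x <= 1 -> `|u j x| <= M) ->
  (forall a e, 0 < e -> exists2 y, rnorm y <= 1 &
    \sum_j a j * c j - e <= \sum_j a j * u j y) ->
  forall e, 0 < e -> exists2 x, rnorm x <= 1 & forall j, `|u j x - c j| <= e.
Proof.
move=> ul; apply: (@approximate_helly _ _ [set x | rnorm x <= 1]).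
move=> x y t /= x1 y1 /andP[t0 t1].
exists ((1 - t)%:C *: x + t%:C *: y) => /=.
  apply: (le_trans (rnormD _ _)); rewrite !rnormZR !ger0_norm ?subr_ge0//.
  have : (1 - t) * rnorm x <= 1 - t by rewrite ler_piMr ?subr_ge0.
  by have : t * rnorm y <= t by [rewrite ler_piMr]; lra.
by move=> j; have [uD uZ] := ul j; rewrite uD !uZ.
Qed.

Lemma limit_functional (u : nat -> X -> R) :
  (forall n, real_linear (u n)) -> (forall n x, `|u n x| <= rnorm x) ->
  exists h, [/\ real_linear h, forall x, `|h x| <= rnorm x &
                forall x, between (u^~ x) (h x)].
Proof.
move=> ul un; have [U [PU Ulim]] := ultrafilter_limit R.
have /choice[h hP] x : exists l, u^~ x @ U --> l /\ between (u^~ x) l.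
  exact: Ulim (un^~ x).
exists h; split=> [|x|x]; last by case: (hP x).
  split=> [x y|t x].
    have [hx _] := hP x; have [hy _] := hP y; have [hxy _] := hP (x + y).
    have uE : u^~ (x + y) = u^~ x \+ u^~ y.
      by apply/funext => n; have [uD _] := ul n; exact: uD.
    rewrite uE in hxy; exact: (cvg_unique _ hxy (cvgD hx hy)).
  have [hx _] := hP x; have [htx _] := hP (t%:C *: x).
  have uE : u^~ (t%:C *: x) = (fun n => t * u n x).
    by apply/funext => n; have [_ uZ] := ul n; exact: uZ.
  rewrite uE in htx; have ht : (fun n => t * u n x) @ U --> t * h x.
    by apply: cvgM => //; exact: cvg_cst.
  exact: (cvg_unique _ htx ht).
have [_ bt] := hP x; rewrite ler_norml; apply/andP; split.
  by apply: (proj1 (bt _ 0%N)) => n _; have := un n x; rewrite ler_norml => /andP[].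
by apply: (proj2 (bt _ 0%N)) => n _; have := un n x; rewrite ler_norml => /andP[].
Qed.

End Functionals.

(** * The canonical embedding into the bidual *)

Lemma opnorm_canonical_embedding (R : realType) (X : normedModType R[i]) (x : X) :
  opnorm (canonical_embedding x) = rnorm x.
Proof.
apply/le_anti/andP; split.
  by apply: opnorm_le (rnorm_ge0 x) _ => f; rewrite rnormE mulrC; exact: (ler_opnorm f x).
have [u [ul un ux]] := norming_functional x.
have [|f fu f1] := complexify ul ler01; first by move=> y; rewrite mul1r.
rewrite -ux -fu; apply: (le_trans (ler_norm _)).
apply: (le_trans (Re_functional_le (canonical_embedding x) f)).
by rewrite ler_piMr ?opnorm_ge0.
Qed.

Lemma history_choice (T : Type) (P : seq T -> T -> Prop) :
  (forall s, exists t, P s t) -> exists g : nat -> T, forall n, P (mkseq g n) (g n).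
Proof.
move=> /choice[F FP]; pose h := fix h n := if n is m.+1 then rcons (h m) (F (h m)) else [::].
have hE n : h n = mkseq (fun n => F (h n)) n.
  by elim: n => // n IH; rewrite mkseqS -IH.
by exists (fun n => F (h n)) => n; rewrite -hE.
Qed.

Lemma canonical_embeddingB (R : realType) (X : normedModType R[i]) (x y : X) :
  canonical_embedding (x - y) = canonical_embedding x - canonical_embedding y.
Proof.
apply/val_inj/funext => f.
change (canonical_embedding (x - y) f =
  (canonical_embedding x - canonical_embedding y : topdual (topdual X)) f).
by rewrite blinopDE -[- canonical_embedding y]scaleN1r blinopZE scaleN1r; exact: linearB.
Qed.

(** * James' theorem *)

Section Representation.
Variables (R : realType) (X : normedModType R[i]).

(** Helly's theorem on the ball of the dual, with target [0] at the points and [d] at [Phi], which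
    takes the last index. A combination with nonzero weight [t] on [Phi] is [t] times the difference
    of [Phi] and an evaluation, hence has norm at least [|t| d]. *)
Lemma small_on_points (Phi : topdual (topdual X)) d e (s : seq X) : 0 < e ->
  (forall x : X, d <= opnorm (Phi - canonical_embedding x)) -> 0 < d ->
  exists f : topdual X, [/\ rnorm f <= 1,
    forall k, (k < size s)%N -> `|complex.Re (f (nth 0 s k))| <= e &
    d - e <= complex.Re (Phi f)].
Proof.
move=> e0 dPhi d0; set n := size s.
pose u (j : 'I_n.+1) (f : topdual X) :=
  if (j < n)%N then complex.Re (f (nth 0 s j)) else complex.Re (Phi f).
pose c (j : 'I_n.+1) := if (j < n)%N then 0 else d.
have evl (x : X) : real_linear (fun f : topdual X => complex.Re (f x)).
  exact: (real_linear_Re (canonical_embedding x)).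
have := @ball_helly R (topdual X) n.+1 u c
  (opnorm Phi + \sum_(j < n) rnorm (nth 0 s j)).
case/(_ _ _ _ e e0) => [j|j f f1|a e' e'0|f f1 uf].
- by rewrite /u; case: (j < n)%N; [exact: evl|exact: real_linear_Re].
- have S0 (P : pred 'I_n) : 0 <= \sum_(j < n | P j) rnorm (nth 0 s j).
    by apply: sumr_ge0 => k _; exact: rnorm_ge0.
  rewrite /u; case: ifPn => [jn|_].
    apply: (le_trans (Re_functional_le _ _)); apply: (@le_trans _ _ (rnorm (nth 0 s j))).
      by apply: ler_piMl => //; exact: rnorm_ge0.
    by rewrite (bigD1 (Ordinal jn))//= addrCA lerDl addr_ge0 ?opnorm_ge0.
  apply: (le_trans (Re_functional_le _ _)).
  apply: (@le_trans _ _ (opnorm Phi)); last by rewrite lerDl S0.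
  by apply: ler_piMr => //; exact: opnorm_ge0.
- pose t := a ord_max; pose y := \sum_(j < n) (a (widen_ord (leqnSn n) j))%:C *: nth 0 s j.
  have uE f : \sum_j a j * u j f = complex.Re (f y) + t * complex.Re (Phi f).
    rewrite big_ord_recr/= /u /= ltnn; congr (_ + _).
    rewrite [RHS](real_linear_sum _ _ (real_linear_Re f)).
    by apply: eq_bigr => j _; rewrite /= ltn_ord.
  have cE : \sum_j a j * c j = t * d.
    rewrite big_ord_recr/= /c /= ltnn big1 ?add0r// => j _.
    by rewrite ltn_ord mulr0.
  rewrite cE; suff [f f1 ft] : exists2 f : topdual X, rnorm f <= 1 &
      t * d - e' <= complex.Re (f y) + t * complex.Re (Phi f).
    by exists f; rewrite ?uE.
  have [t0|t0] := eqVneq t 0.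
    exists 0; first by rewrite /rnorm normr0.
    by rewrite t0 !mul0r sub0r addr0 oppr_le0 ltW.
  pose Xi := t%:C *: (Phi - canonical_embedding (- (t^-1)%:C *: y)).
  have XiE f : complex.Re (Xi f) = complex.Re (f y) + t * complex.Re (Phi f).
    have -> : Xi f = f y + t%:C * Phi f.
      rewrite blinopZE blinopDE -scaleN1r blinopZE.
      rewrite -[canonical_embedding _ f]/(f (- (t^-1)%:C *: y)) linearZ/=.
      rewrite /GRing.scale/= fmorphV; field.
      by apply/eqP => /complexI/eqP; apply/negP.
    by rewrite raddfD; case: (Phi f) => a' b /=; rewrite mul0r subr0.
  have [f f1 fXi] := Re_functional_sup Xi e'0.
  exists f => //; rewrite -XiE; apply: le_trans fXi; rewrite lerD2r.
  have -> : opnorm Xi = `|t| * opnorm (Phi - canonical_embedding (- (t^-1)%:C *: y)).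
    by rewrite -!rnorm_dual rnormZR.
  apply: (@le_trans _ _ (`|t| * d)); first by rewrite ler_pM2r// ler_norm.
  by rewrite ler_wpM2l.
- exists f; split=> // [k kn|].
    by have := uf (widen_ord (leqnSn n) (Ordinal kn)); rewrite /u /c /= kn subr0.
  by have := uf ord_max; rewrite /u /c /= ltnn ler_norml; lra.
Qed.

(** A Goldstine-type statement from Helly's theorem in [X]; dividing by [1 + opnorm Phi] brings the
    targets within reach of the unit ball and avoids a zero denominator. *)
Lemma represent_on_functionals (Phi : topdual (topdual X)) e (s : seq (topdual X)) :
  0 < e -> exists2 x : X, rnorm x <= 1 & forall k, (k < size s)%N ->
    `|complex.Re (nth 0 s k x) - complex.Re (Phi (nth 0 s k)) / (1 + opnorm Phi)| <= e.
Proof.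
move=> e0; set n := size s; set K := 1 + opnorm Phi.
have K0 : 0 < K by rewrite ltr_pwDl ?opnorm_ge0.
pose u (j : 'I_n) (x : X) := complex.Re (nth 0 s j x).
pose c (j : 'I_n) := complex.Re (Phi (nth 0 s j)) / K.
have := @ball_helly R X n u c (\sum_(j < n) opnorm (nth 0 s j)).
case/(_ _ _ _ e e0) => [j|j x x1|a e' e'0|x x1 ux].
- exact: real_linear_Re.
- apply: (le_trans (Re_functional_le _ _)).
  rewrite (bigD1 j)//= (le_trans (_ : _ <= opnorm (nth 0 s j)))//.
    by apply: ler_piMr => //; exact: opnorm_ge0.
  by rewrite lerDl; apply: sumr_ge0 => k _; exact: opnorm_ge0.
- pose F := \sum_j (a j)%:C *: nth 0 s j : topdual X.
  have uE x : \sum_j a j * u j x = complex.Re (F x).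
    by rewrite [RHS](real_linear_sum _ _ (real_linear_Re (canonical_embedding x))).
  have cE : \sum_j a j * c j = complex.Re (Phi F) / K.
    rewrite [complex.Re _](real_linear_sum _ _ (real_linear_Re Phi)) mulr_suml.
    by apply: eq_bigr => j _; rewrite /c mulrA.
  have [x x1 Fx] := Re_functional_sup F e'0.
  exists x => //; rewrite uE cE; apply: le_trans Fx; rewrite lerD2r ler_pdivrMr//.
  apply: (le_trans (ler_norm _)); apply: (le_trans (Re_functional_le _ _)).
  by rewrite rnorm_dual mulrC ler_wpM2l ?opnorm_ge0// /K lerDr.
- by exists x => // k kn; exact: (ux (Ordinal kn)).
Qed.

End Representation.

Section James.
Variables (R : realType) (X : completeNormedModType R[i]).

(** The isometric image of the complete space [X] is closed: points whose evaluations approach [Phi]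
    form a Cauchy sequence, and evaluation at its limit would be [Phi]. *)
Lemma evaluation_distance (Phi : topdual (topdual X)) :
  ~ (exists x : X, canonical_embedding x = Phi) ->
  exists2 d : R, 0 < d & forall x : X, d <= opnorm (Phi - canonical_embedding x).
Proof.
move=> nPhi; apply: contrapT => /forall2NP nd.
have approx (d : R) : 0 < d -> exists x : X, opnorm (Phi - canonical_embedding x) < d.
  move=> d0; have [//|/existsNP[x /negP]] := nd d.
  by rewrite -ltNge => lt; exists x.
have n1 n : 0 < n.+1%:R^-1 :> R by rewrite invr_gt0.
have /choice[x xP] n := approx _ (n1 n).
have dist y z : rnorm (y - z) <=
    opnorm (Phi - canonical_embedding y) + opnorm (Phi - canonical_embedding z).
  rewrite -opnorm_canonical_embedding -!rnorm_dual.
  have -> : canonical_embedding (y - z) =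
      (Phi - canonical_embedding z) - (Phi - canonical_embedding y).
    by rewrite opprB [RHS]addrC addrA subrK canonical_embeddingB.
  by rewrite (le_trans (rnormD _ _))// rnormN addrC.
have small (r : R) : 0 < r -> exists N, forall n, (N <= n)%N ->
    opnorm (Phi - canonical_embedding (x n)) < r.
  move=> r0; have [N _ NP] := near_infty_natSinv_lt (PosNum r0).
  exists N => n Nn; exact: lt_trans (xP n) (NP n Nn).
have posR (r : R[i]) : 0 < r -> exists2 s : R, 0 < s & r = s%:C.
  by case: r => a b; rewrite ltcE /= => /andP[/eqP -> a0]; exists a.
have xc : cauchy (x @ \oo).
  apply: cauchy_exP => _ /posR[s s0 ->].
  have [|N NP] := small (s / 2); first by rewrite divr_gt0.
  exists (x N), N => // n /= Nn; rewrite -ball_normE /ball_/= -rnormE ltcR.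
  by apply: (le_lt_trans (dist _ _)); have := NP n Nn; have := NP N (leqnn N); lra.
have /cvg_ex[l xl] : cvg (x @ \oo) by apply: cauchy_cvg.
apply: nPhi; exists l; apply/eqP; rewrite eq_sym -subr_eq0 -normr_le0.
rewrite -rnormE lecR leNgt; apply/negP => r0; set r := rnorm _ in r0.
have [|N NP] := small (r / 2); first by rewrite divr_gt0.
have /cvgrPdist_lt xl' := xl.
have [|M _ MP] := xl' (r / 2)%:C; first by rewrite ltcR divr_gt0.
have := MP (maxn N M) (leq_maxr _ _); have := NP (maxn N M) (leq_maxl _ _).
set y := x _ => ry /=; rewrite -rnormE ltcR => ly.
have : r <= opnorm (Phi - canonical_embedding y) + rnorm (l - y).
  rewrite -rnormN opprB -(opnorm_canonical_embedding (y - l)) -!rnorm_dual.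
  rewrite /r; have -> : Phi - canonical_embedding l =
      (Phi - canonical_embedding y) + canonical_embedding (y - l).
    by rewrite canonical_embeddingB addrA subrK.
  exact: rnormD.
by lra.
Qed.

(** Each stage picks a functional small on the earlier points where [Phi] is large, then a point
    representing [Phi / K] on all functionals so far. *)
Lemma biorthogonal_sequence (Phi : topdual (topdual X)) :
  ~ (exists x : X, canonical_embedding x = Phi) ->
  exists2 e : R, 0 < e & exists (fs : nat -> topdual X) (xs : nat -> X),
  [/\ forall n, opnorm (fs n) <= 1, forall n, rnorm (xs n) <= 1,
      forall k n, (k < n)%N -> `|complex.Re (fs n (xs k))| <= e &
      forall j n, (j <= n)%N -> 3 * e <= complex.Re (fs j (xs n))].
Proof.
move=> nPhi; have [d d0 dPhi] := evaluation_distance nPhi.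
set K := 1 + opnorm Phi.
have K1 : 1 <= K by rewrite lerDl opnorm_ge0.
have K0 : 0 < K by lra.
(* With [Re (Phi f) >= d - e] and [K >= 1], the value at a representing point is at least
   [5e - e - e = 3e]. *)
pose e := d / (5 * K).
have e0 : 0 < e by rewrite divr_gt0// mulr_gt0.
have dE : d / K = 5 * e by rewrite /e; field; rewrite gt_eqF.
exists e => //.
pose P (s : seq (topdual X * X)) (t : topdual X * X) :=
  [/\ rnorm t.1 <= 1, rnorm t.2 <= 1,
   forall k, (k < size s)%N -> `|complex.Re (t.1 (nth (0, 0) s k).2)| <= e,
   d - e <= complex.Re (Phi t.1) &
   (* [rcons s t] includes the functional of the current pair, so the diagonal values are large
      too. *)
   forall k, (k <= size s)%N ->
     let f := (nth (0, 0) (rcons s t) k).1 in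
     `|complex.Re (f t.2) - complex.Re (Phi f) / K| <= e].
have [|g gP] := @history_choice _ P.
  move=> s; have [f [f1 fs fPhi]] := small_on_points (map snd s) e0 dPhi d0.
  have [x x1 xs] := represent_on_functionals Phi (rcons (map fst s) f) e0.
  exists (f, x); split=> //= k ks.
    by have := fs k; rewrite size_map (nth_map (0, 0))//; exact.
  have := xs k; rewrite size_rcons size_map ltnS => /(_ ks).
  rewrite !nth_rcons size_map.
  by case: ifP => kls; [rewrite (nth_map (0, 0))|case: ifP].
exists (fun n => (g n).1), (fun n => (g n).2).
have fPhi n : d - e <= complex.Re (Phi (g n).1) by case: (gP n).
split=> [n|n|k n kn|j n jn].
- by case: (gP n).
- by case: (gP n).
- by have [_ _ /(_ k) + _ _] := gP n; rewrite size_mkseq nth_mkseq//; exact.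
- have [_ _ _ _ /(_ j)] := gP n; rewrite size_mkseq -mkseqS nth_mkseq// => /(_ jn) /=.
  have : (d - e) / K <= complex.Re (Phi (g j).1) / K by rewrite ler_pM2r ?invr_gt0.
  have : e / K <= e by rewrite ler_pdivrMr// ler_peMr// ltW.
  by rewrite mulrBl dE ler_norml; lra.
Qed.

Lemma nonattaining_functional (Phi : topdual (topdual X)) :
  ~ (exists x : X, canonical_embedding x = Phi) ->
  exists F : topdual X, forall x, rnorm x <= 1 -> complex.Re (F x) < opnorm F.
Proof.
move=> /biorthogonal_sequence[e e0 [fs [xs [fs1 xs1 fx_small fx_large]]]].
(* Real parts of convex combinations of [fs N, fs N.+1, ...] lie in [G N]. *)
pose G N : set (X -> R) := [set u | [/\ real_linear u, forall x, `|u x| <= rnorm x,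
  forall k, (k < N)%N -> `|u (xs k)| <= e &
  exists m, forall k, (m <= k)%N -> 3 * e <= u (xs k)]].
have Re1 n x : `|complex.Re (fs n x)| <= rnorm x.
  by apply: le_trans (Re_functional_le _ _) _; rewrite ler_piMl ?rnorm_ge0.
have e1 : 3 * e <= 1.
  apply: le_trans (fx_large 0%N 0%N _) _ => //.
  by apply: (le_trans (ler_norm _)); exact: (le_trans (Re1 _ _)).
have Gdecr m n : (m <= n)%N -> G n `<=` G m.
  move=> mn u [ul un us uL]; split=> // k km; apply: us; exact: leq_trans mn.
have conv_norm (a b c t : R) : 0 <= t <= 1 -> `|a| <= c -> `|b| <= c ->
    `|t * a + (1 - t) * b| <= c.
  rewrite !ler_norml => t01 /andP[a1 a2] /andP[b1 b2].
  apply/andP; split; first exact: convex_ge.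
  rewrite -lerN2; have -> : - (t * a + (1 - t) * b) = t * - a + (1 - t) * - b by ring.
  by apply: convex_ge; rewrite ?lerN2.
have Gconvex n : convex_fun_set (G n).
  move=> u v t [[uD uZ] un us [mu uL]] [[vD vZ] vn vs [mv vL]] t01; split.
  - by split=> [x y|s x]; rewrite ?uD ?vD ?uZ ?vZ; ring.
  - by move=> x; exact: conv_norm.
  - by move=> k kn; apply: conv_norm => //; [exact: us|exact: vs].
  - exists (maxn mu mv) => k; rewrite geq_max => /andP[muk mvk].
    by apply: convex_ge => //; [exact: uL|exact: vL].
have Gnonempty n : exists u, G n u.
  exists (fun x => complex.Re (fs n x)); split=> //.
  - exact: real_linear_Re.
  - by move=> k; exact: fx_small.
  - by exists n => k; exact: fx_large.
pose B := [set x : X | rnorm x <= 1].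
have Gbounded u x : G 0%N u -> B x -> `|u x| <= 1.
  by move=> [_ un _ _] Bx; apply: le_trans (un x) Bx.
have Ggap u : G 0%N u -> exists x N, B x /\ forall v, G N v -> 2 * e <= u x - v x.
  (* At [xs m] the functional [u] is at least [3 e], while members of [G m.+1] are at most [e]
     there. *)
  move=> [_ _ _ [m um]]; exists (xs m), m.+1; split; first exact: xs1.
  move=> v [_ _ /(_ m (ltnSn m)) vs _]; have := um m (leqnn m).
  by move: vs; rewrite ler_norml; lra.
(* The choices [kap = e] and [r = e / 4] fit the gap [2 e]. *)
have r01 : 0 < e / 4 < 1 by lra.
have kth : e + 2 * (e / 4) < 2 * e by lra.
have [p [g [p0 pS Gg nomax]]] :=
  no_max Gdecr Gconvex Gnonempty Gbounded Ggap r01 e0 kth.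
have [r0 r1] := andP r01; set r := e / 4 in r0 r1 pS.
have gl n : real_linear (g n) by case: (Gg n).
have gn n x : `|g n x| <= rnorm x by case: (Gg n).
have pl n : real_linear (p n).
  elim: n => [|n [pD pZ]]; first by rewrite p0; split=> *; rewrite ?addr0 ?mulr0.
  have [gD gZ] := gl n; rewrite pS.
  by split=> [x y|t x]; rewrite ?gD ?pD ?gZ ?pZ; ring.
(* The weights used so far sum to [1 - r ^+ n]; keeping this factor makes the induction work. *)
have pn' n x : `|p n x| <= (1 - r ^+ n) * rnorm x.
  elim: n => [|n IH]; first by rewrite p0 normr0 expr0 subrr mul0r.
  rewrite pS (le_trans (ler_normD _ _))//.
  have : `|(1 - r) * r ^+ n * g n x| <= (1 - r) * r ^+ n * rnorm x.
    have rn : 0 <= (1 - r) * r ^+ n by rewrite mulr_ge0 ?exprn_ge0 ?subr_ge0 ?ltW.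
    by rewrite normrM ger0_norm// ler_wpM2l.
  by move: IH; rewrite exprS; lra.
have pn n x : `|p n x| <= rnorm x.
  by apply: (le_trans (pn' n x)); rewrite ler_piMl ?rnorm_ge0// gerBl exprn_ge0// ltW.
have [h [[hD hZ] hn ph]] := limit_functional pl pn.
have [w [[wD wZ] wn gw]] := limit_functional gl gn.
have hwl : real_linear (fun x => h x - w x).
  by split=> [x y|t x]; rewrite ?hD ?wD ?hZ ?wZ; ring.
have hwn x : `|h x - w x| <= 2 * rnorm x.
  apply: le_trans (ler_normB _ _) _.
  by have := hn x; have := wn x; lra.
have [F FE _] := complexify hwl (ler0n _ 2) hwn.
exists F => x Bx.
have [y By lt] := nomax h w (fun x _ => ph x) (fun x _ => gw x) x Bx.
rewrite FE (lt_le_trans lt)// -FE.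
apply: (le_trans (ler_norm _)); apply: (le_trans (Re_functional_le _ _)).
by apply: ler_piMr => //; exact: opnorm_ge0.
Qed.

End James.

(** * Birkhoff-James orthogonality to a kernel and norm attainment *)

(** Reflexivity represents a functional norming [F] by a point [z] of the unit ball; adding a kernel
    vector leaves [F z] unchanged, so the norm stays at least [1]. *)
Lemma reflexive_BJ (R : realType) (X : normedModType R[i]) (F : topdual X) :
  reflexive_space X -> F <> 0 ->
  exists2 z : X, z <> 0 & BJ_orthogonal_set z [set y | F y = 0].
Proof.
move=> refl F0.
have [u [ul un uF]] := norming_functional F.
have [|Psi Psiu Psi1] := complexify ul ler01; first by move=> G; rewrite mul1r.
have [z _ zPsi] := refl Psi I.
have nF : 0 < opnorm F by exact: (rnorm_gt0 F0).
have Fz : complex.Re (F z) = opnorm F.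
  by rewrite -[F z]/(canonical_embedding z F) zPsi Psiu uF.
have z1 : rnorm z <= 1 by rewrite -opnorm_canonical_embedding zPsi.
exists z => [z0|y Fy l]; first by move: nF; rewrite -Fz z0 linear0 ltxx.
rewrite -!rnormE lecR (le_trans z1)// -(ler_pM2l nF) mulr1.
apply: le_trans (Re_functional_le F (z + l *: y)).
by rewrite linearD linearZ /= Fy scaler0 addr0 Fz ler_norm.
Qed.

(** If [F y] is nonzero and [l = F z / F y], then [l y] is [z] plus a kernel vector; orthogonality
    yields [|F y| / |y| <= |F z| / |z|], so a rotated multiple of [z] attains the norm. *)
Lemma BJ_attains (R : realType) (X : normedModType R[i]) (F : topdual X) (z : X) :
  z <> 0 -> BJ_orthogonal_set z [set y | F y = 0] ->
  exists2 x, rnorm x <= 1 & opnorm F <= complex.Re (F x).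
Proof.
move=> z0 zF.
have nz := rnorm_gt0 z0.
(* A kernel vector [z] would be orthogonal to itself, and the scalar [-1] would give [|z| <= 0]. *)
have Fz0 : F z != 0.
  apply/eqP => /zF/(_ (-1)); rewrite scaleN1r subrr normr0 -rnormE -[0]/(0%:C) lecR.
  by rewrite leNgt nz.
have [c c1 cF] := unit_rotation (F z).
have FzE : (complex.Re `|F z|)%:C = `|F z| by rewrite RRe_real// normr_real.
have reF : 0 <= complex.Re `|F z| by rewrite -ler0c FzE.
exists ((c / (rnorm z)%:C) *: z).
  rewrite -lecR [leLHS]rnormE normrZ normrM c1 mul1r normfV rnormE normr_id.
  by rewrite mulVf // normr_eq0; apply/eqP.
have -> : complex.Re (F ((c / (rnorm z)%:C) *: z)) = complex.Re `|F z| / rnorm z.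
  by rewrite linearZ /= -[_ *: _]/(_ * _) mulrAC cF -[`|F z|]FzE -fmorphV -rmorphM.
apply: opnorm_le; first by rewrite divr_ge0 ?reF// rnorm_ge0.
move=> y; have [->|Fy0] := eqVneq (F y) 0.
  by rewrite normr0 mulr_ge0// ler0c divr_ge0 ?reF// rnorm_ge0.
pose l := F z / F y.
have ker : F (y - (F y / F z) *: z) = 0.
  by rewrite linearB linearZ /= -[_ *: _]/(_ * _) divfK// subrr.
have := zF _ ker l.
have -> : z + l *: (y - (F y / F z) *: z) = l *: y.
  rewrite scalerBr scalerA.
  have -> : l * (F y / F z) = 1 by rewrite /l; field; rewrite Fz0 Fy0.
  by rewrite scale1r addrC subrK.
rewrite normrZ /l normf_div => le.
have -> : (complex.Re `|F z| / rnorm z)%:C = `|F z| / `|z|.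
  by rewrite -[`|z|]rnormE -fmorphV -FzE -rmorphM.
rewrite -(ler_pM2r (_ : 0 < `|z| / `|F y|)); last first.
  by rewrite divr_gt0 ?normr_gt0//; apply/eqP.
have -> : `|F y| * (`|z| / `|F y|) = `|z| by rewrite mulrCA divff ?mulr1 ?normr_eq0.
apply: le_trans le _; rewrite le_eqVlt; apply/orP; left; apply/eqP.
have : `|z| != 0 by rewrite normr_eq0; apply/eqP.
have : `|F y| != 0 by rewrite normr_eq0.
move: (`|z|) (`|F y|) (`|F z|) (`|y|) => a b c' d b0 a0.
by field; rewrite a0 b0.
Qed.

Theorem proposition2p13 (R : realType) (X : completeNormedModType R[i])
    (T : blinop X (topdual X)) (T_bij : bijective T) :
  reflexive_space X <->
  (forall x : X, x <> 0 ->
     exists2 z : X, z <> 0 & BJ_orthogonal_set z (T_orthocomplement T x)).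
Proof.
split=> [refl x x0|BJ].
  apply: (@reflexive_BJ _ _ (T x)) => // Tx0; apply: x0.
  by apply: (bij_inj T_bij); rewrite Tx0 linear0.
move=> Phi _; apply: contrapT => nPhi.
have [|F Flt] := @nonattaining_functional _ _ Phi.
  by move=> [x xPhi]; apply: nPhi; exists x.
have [S _ TS] := T_bij.
(* The zero functional attains its norm at [0], so [F] and its preimage under [T] are nonzero. *)
have Sx0 : S F <> 0.
  move=> S0; have F0 : F = 0 by rewrite -(TS F) S0 linear0.
  by have := Flt 0; rewrite F0 -rnorm_dual /rnorm !normr0 ltxx => /(_ ler01).
have [z z0 zF] := BJ _ Sx0.
rewrite /T_orthocomplement /T_orthogonal TS in zF.
have [x x1] := BJ_attains z0 zF.
by rewrite leNgt Flt.
Qed.
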